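(* Let $\Sigma=\{1,2,\ldots,n\}$ be a finite ordered alphabet, let $M=[1^{m_1},2^{m_2},\ldots,n^{m_n}]$ be a multiset over $\Sigma$ of cardinality $N=m_1+\cdots+m_n>1$, and let $u_1,\ldots,u_n$ be formal commuting variables, one for each letter of $\Sigma$. Let $E$ be the set of all even $N$-words over $M$ and $O$ the set of all odd $N$-words over $M$. Then the weighted sum of even $N$-words over $M$ equals the weighted sum of odd $N$-words over $M$: $$\sum_{w\in E} wt(w)=\sum_{w\in O} wt(w).$$
   Context: Words. $\Sigma=\{1,\ldots,n\}$ is ordered by $1<2<\cdots<n$. $\Sigma^{\star}$ is the set of all finite words over $\Sigma$ and $\Sigma^{+}$ the set of non-empty words. The lexicographic order $\trianglelefteq$ on $\Sigma^\star$ is given by: $w_1\trianglelefteq w_2$ if either $w_1$ is a prefix of $w_2$ (i.e. $w_2=w_1u$ for some $u\in\Sigma^\star$), or $w_1=ras$, $w_2=rbt$ with $r,s,t\in\Sigma^\star$, $a,b\in\Sigma$, $a<b$. Write $w_1\vartriangleleft w_2$ (equivalently $w_2\vartriangleright w_1$) if $w_1\trianglelefteq w_2$ and $w_1\ne w_2$. Lyndon words. A word $w\in\Sigma^+$ is primitive if $w=u^k$ with $u\in\Sigma^+$ implies $k=1$. Two words $w,u$ are conjugate if $w=w_1w_2$ and $u=w_2w_1$ for some words $w_1,w_2$. A Lyndon word is a primitive word that is the smallest in its conjugacy class with respect to the lexicographic order; $L$ denotes the set of Lyndon words. Every word $w\in\Sigma^+$ can be written uniquely as a non-increasing product of Lyndon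 words $w=l_1l_2\cdots l_h$, $l_i\in L$, $l_1\trianglerighteq l_2\trianglerighteq\cdots\trianglerighteq l_h$ (its Lyndon factorization). Multisets and $N$-words. $M=[1^{m_1},\ldots,n^{m_n}]$ is the multiset with $m_i$ occurrences of $i$; its cardinality is $N=m_1+\cdots+m_n$. An $N$-word over $M$ is a word $w=w_1w_2\cdots w_N$ which is a permutation of $M$, i.e. each letter $i$ occurs exactly $m_i$ times in $w$. Lyndon tuple, index, parity. If the Lyndon factorization $w=l_1l_2\cdots l_k$ of an $N$-word $w$ over $M$ has pairwise distinct factors, i.e. $l_1\vartriangleright l_2\vartriangleright\cdots\vartriangleright l_k$, then $tup(w)=(l_k,\ldots,l_2,l_1)$ is the Lyndon tuple of $w$, and the Lyndon index of $w$ is $i_l(w)=N-k$. Words whose Lyndon factorization has a repeated factor have no Lyndon tuple and no Lyndon index. An $N$-word over $M$ that has a Lyndon tuple is called even (resp. odd) if $i_l(w)$ is even (resp. odd); words without a Lyndon tuple are neither even nor odd. Weights. For a Lyndon word $l=i_1i_2\cdots i_h$ (with $i_j\in\Sigma$), $wt(l)=u_{i_1}u_{i_2}\cdots u_{i_h}$. For an $N$-word $w$ having a Lyndon tuple, $wt(w)=\prod_{l\in tup(w)}wt(l)$. The identity is an identity of polynomials in $u_1,\ldots,u_n$. *)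

(* Defs.v *)
From HB Require Import structures.
From mathcomp Require Import all_boot all_order all_algebra.
From mathcomp Require Import boolp classical_sets.
From mathcomp Require Import mpoly.

Set Implicit Arguments.
Unset Strict Implicit.
Unset Printing Implicit Defensive.

Import Order.TTheory GRing.Theory.

(* The letter i of the alphabet {1, ..., n} is the ordinal i - 1 of 'I_n. *)
Notation word n := (seq 'I_n).

(* The lexicographic order is the canonical order of mathcomp on seqlexi;
   word_leP shows that it is the order where prefixes are smaller. *)
Definition word_le (n : nat) (w1 w2 : word n) : bool :=
  ((w1 : seqlexi 'I_n) <= (w2 : seqlexi 'I_n))%O.

Lemma word_leP (n : nat) (w1 w2 : word n) :
  word_le w1 w2 <->
  (exists u : word n, w2 = w1 ++ u) \/
  (exists (r s t : word n) (a b : 'I_n),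
     [/\ w1 = r ++ a :: s, w2 = r ++ b :: t & (a < b)%N]).
Proof.
rewrite /word_le; elim: w1 w2 => [|x w1 IH] [|y w2].
- by split=> // _; left; exists [::].
- by split=> // _; left; exists (y :: w2).
- by split=> // -[[u //]|[[|r0 r] [s [t [a [b []]]]]]].
- rewrite lexi_cons; split.
  + case/andP; rewrite le_eqVlt => /predU1P[<-{y}|xy _].
      rewrite lexx /= => /IH[[u ->]|[r [s [t [a [b [-> -> ab]]]]]]].
        by left; exists u.
      by right; exists (x :: r), s, t, a, b.
    by right; exists [::], w1, w2, x, y.
  + case=> [[u [-> ->]]|[[|r0 r] [s [t [a [b [/= [-> e1] [-> e2] ab]]]]]]].
    * by rewrite lexx /=; apply/IH; left; exists u.
    * have ab' : (a < b)%O := ab.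
      by rewrite (ltW ab') /= leNgt ab'.
    * by rewrite lexx /=; apply/IH; right; exists r, s, t, a, b.
Qed.

Definition word_pow (n : nat) (u : word n) (k : nat) : word n :=
  flatten (nseq k u).

Definition primitive_word (n : nat) (w : word n) : Prop :=
  w <> [::] /\
  forall (u : word n) (k : nat), u <> [::] -> w = word_pow u k -> k = 1%N.

Definition conjugate_words (n : nat) (w u : word n) : Prop :=
  exists w1 w2 : word n, w = w1 ++ w2 /\ u = w2 ++ w1.

Definition Lyndon_word (n : nat) (w : word n) : Prop :=
  primitive_word w /\ forall u : word n, conjugate_words w u -> word_le w u.

Definition is_Lyndon_factorization (n : nat) (w : word n)
    (ls : seq (word n)) : Prop :=
  [/\ flatten ls = w,
      forall l : word n, l \in ls -> Lyndon_word l
    & sorted (fun l l' : word n => word_le l' l) ls].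

(* Chosen classically: by the Chen-Fox-Lyndon theorem exactly one sequence
   satisfies is_Lyndon_factorization w, so the default is never used. *)
Definition Lyndon_factorization (n : nat) (w : word n) : seq (word n) :=
  xget [::] (fun ls : seq (word n) => is_Lyndon_factorization w ls).

Definition has_Lyndon_tuple (n : nat) (w : word n) : bool :=
  uniq (Lyndon_factorization w).

(* Lyndon_tuple, Lyndon_index and wt are total functions, but are only
   meaningful for words satisfying has_Lyndon_tuple. *)
Definition Lyndon_tuple (n : nat) (w : word n) : seq (word n) :=
  rev (Lyndon_factorization w).

(* The truncated subtraction is exact: the factors are not empty. *)
Definition Lyndon_index (n : nat) (w : word n) : nat :=
  (size w - size (Lyndon_tuple w))%N.

Definition even_word (n : nat) (w : word n) : bool :=
  has_Lyndon_tuple w && ~~ odd (Lyndon_index w).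

Definition odd_word (n : nat) (w : word n) : bool :=
  has_Lyndon_tuple w && odd (Lyndon_index w).

Definition wt_Lyndon (n : nat) (l : word n) : {mpoly int[n]} :=
  (\prod_(i <- l) 'X_i)%R.

Definition wt (n : nat) (w : word n) : {mpoly int[n]} :=
  (\prod_(l <- Lyndon_tuple w) wt_Lyndon l)%R.

(* A multiset over the alphabet is given by its multiplicities. *)
Definition mset_card (n : nat) (m : 'I_n -> nat) : nat := (\sum_(i < n) m i)%N.

Definition Nwords (n : nat) (m : 'I_n -> nat) :
    {set (mset_card m).-tuple 'I_n} :=
  [set w : (mset_card m).-tuple 'I_n | [forall i, count_mem i w == m i]].

Definition even_Nwords (n : nat) (m : 'I_n -> nat) :
    {set (mset_card m).-tuple 'I_n} :=
  [set w in Nwords m | even_word w].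

Definition odd_Nwords (n : nat) (m : 'I_n -> nat) :
    {set (mset_card m).-tuple 'I_n} :=
  [set w in Nwords m | odd_word w].

(* Main.v *)
Require Import Defs.
From HB Require Import structures.
From mathcomp Require Import all_boot all_order all_algebra.
From mathcomp Require Import boolp classical_sets mpoly zify.

Set Implicit Arguments.
Unset Strict Implicit.
Unset Printing Implicit Defensive.

Import Order.TTheory GRing.Theory.

(** All the words over M have the same weight, namely the product of the
    u_i ^ m_i, so the identity says that there are as many even words as odd
    ones: the signs (-1)^k, where k is the number of Lyndon factors, of the
    words over M with distinct factors add up to 0.  This is the coefficient
    of u^M in the identity prod_l (1 - wt l) = 1 - (u_1 + ... + u_n), the
    product being over all Lyndon words.

    The proof lifts that identity to noncommuting variables, where it holds
    word by word.  Reversing the strictly decreasing Lyndon factorization of a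
    word and concatenating gives another word over M, together with one of its
    factorizations into strictly increasing Lyndon words, and every such pair
    arises exactly once ([sum_Lyndon_tuples]).  Let a(x) be the sum of (-1)^k
    over the factorizations of a single word x into k strictly increasing
    Lyndon words ([signed_increasing]).  It suffices that a(x) = 0 as soon as
    x has at least two letters ([signed_increasing_eq0]).

    Consider the sum of a(y) over all the splittings x = yv of a nonempty x.
    By the Chen-Fox-Lyndon theorem v has exactly one nonincreasing
    factorization, so this is a signed sum over the sequences of Lyndon words
    with product x that are cut into a strictly increasing part followed by a
    nonincreasing part.  For a fixed nonempty sequence, the admissible cuts
    come in pairs, obtained by moving across the cut the larger of the two
    words next to it (the left one if they are equal), and the two cuts of a
    pair have opposite signs ([sum_boundary_eq0]).  Hence the sum of a over
    all the prefixes of x is 0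
    ([sum_prefix_signed_increasing]).  Subtracting the same statement for x
    deprived of its last letter gives a(x) = 0. *)

(** * The lexicographic order and concatenation *)

Definition word_lt (n : nat) (u v : word n) : bool :=
  ((u : seqlexi 'I_n) < (v : seqlexi 'I_n))%O.

Lemma word_le_refl (n : nat) (u : word n) : word_le u u.
Proof. exact: (@le_refl _ (seqlexi 'I_n)). Qed.

Lemma word_leNgt (n : nat) (u v : word n) : word_le u v = ~~ word_lt v u.
Proof. exact: (@leNgt _ (seqlexi 'I_n)). Qed.

Lemma word_ltNge (n : nat) (u v : word n) : word_lt u v = ~~ word_le v u.
Proof. exact: (@ltNge _ (seqlexi 'I_n)). Qed.

Lemma word_lt_neqAle (n : nat) (u v : word n) :
  word_lt u v = (u != v) && word_le u v.
Proof. exact: (@lt_neqAle _ (seqlexi 'I_n)). Qed.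

Lemma word_ltW (n : nat) (u v : word n) : word_lt u v -> word_le u v.
Proof. exact: (@ltW _ (seqlexi 'I_n)). Qed.

Lemma word_ltxx (n : nat) (u : word n) : word_lt u u = false.
Proof. exact: (@ltxx _ (seqlexi 'I_n)). Qed.

Lemma word_le_trans (n : nat) (v u w : word n) :
  word_le u v -> word_le v w -> word_le u w.
Proof. exact: (@le_trans _ (seqlexi 'I_n)). Qed.

Lemma word_lt_le_trans (n : nat) (v u w : word n) :
  word_lt u v -> word_le v w -> word_lt u w.
Proof. exact: (@lt_le_trans _ (seqlexi 'I_n)). Qed.

Lemma word_le_cat2l (n : nat) (r u v : word n) :
  word_le (r ++ u) (r ++ v) = word_le u v.
Proof.
by elim: r => //= x r <-; rewrite /word_le lexi_cons lexx.
Qed.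

Lemma word_lt_cat2l (n : nat) (r u v : word n) :
  word_lt (r ++ u) (r ++ v) = word_lt u v.
Proof. by rewrite !word_ltNge word_le_cat2l. Qed.

Lemma word_le_catr (n : nat) (u s : word n) : word_le u (u ++ s).
Proof. by apply/word_leP; left; exists s. Qed.

(** When u is not a prefix of v, the order is decided at a mismatch, which
    survives any continuation of the two words. *)
Lemma word_lt_cat (n : nat) (u v s t : word n) :
  word_lt u v -> ~~ prefix u v -> word_lt (u ++ s) (v ++ t).
Proof.
move=> /word_ltW/word_leP[[z ->]|[r [s' [t' [a [b [-> -> ab]]]]]] _].
  by rewrite prefix_prefix.
rewrite -!catA word_lt_cat2l word_ltNge /word_le !cat_cons lexi_cons.
by have -> : (b <= a)%O = false by apply/negbTE; rewrite -ltNge.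
Qed.

(** * Lyndon words *)

Lemma word_powD (n : nat) (t : word n) i j :
  word_pow t (i + j) = word_pow t i ++ word_pow t j.
Proof. by rewrite /word_pow nseqD flatten_cat. Qed.

Lemma cat_overlap (T : eqType) (x y u v : seq T) :
  x ++ y = u ++ v -> size u <= size x -> exists2 s, x = u ++ s & v = s ++ y.
Proof.
elim: u x => [|c u IH] [|d x] //=; first by exists [::].
- by exists (d :: x).
- by case=> -> /IH{}IH /IH[s -> ->]; exists s.
Qed.

(** Euclid's algorithm on the lengths: the shorter word is a prefix of the
    longer one, and it commutes with the rest. *)
Lemma commuting_words (n : nat) (u v : word n) :
  u ++ v = v ++ u -> exists t i j, u = word_pow t i /\ v = word_pow t j.
Proof.
have [k] := ubnP (size u + size v); elim: k => // k IH in u v *.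
wlog le_uv : u v / size u <= size v => [hw|].
  case/orP: (leq_total (size u) (size v)) => [/hw//|le_vu lt_k /esym E].
  have [|t [i [j [-> ->]]]] := hw v u le_vu _ E; first by rewrite addnC.
  by exists t, j, i.
case: u => [|c u] in le_uv *.
  by exists v, 0, 1; rewrite /word_pow /= cats0.
rewrite ltnS => lt_k E.
have [z Ez E'] := cat_overlap (esym E) le_uv; subst v.
have [||t [i [j [Eu Ej]]]] := IH (c :: u) z.
- by move: lt_k; rewrite size_cat /=; lia.
- by rewrite E'.
by exists t, i, (i + j); rewrite word_powD -Eu -Ej.
Qed.

Definition below_suffixes (n : nat) (w : word n) : Prop :=
  w <> [::] /\
  forall u v : word n, w = u ++ v -> u <> [::] -> v <> [::] -> word_lt w v.

(** The usable form of the definition.  If w = uv is a Lyndon word and v <= w,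
    then v must be a prefix of w, since otherwise the conjugate vu would be
    smaller than w; writing w = vz, the inequality vz < vu gives z < u, and
    then the conjugate zv is smaller than w.  Conversely w < v <= vu for the
    conjugates vu of w, and a power u^k with k > 1 has its proper suffix
    u^(k-1) as a prefix, hence is greater than it. *)
Lemma Lyndon_wordP (n : nat) (w : word n) :
  Lyndon_word w <-> below_suffixes w.
Proof.
split=> [[[w0 prim] minw]|[w0 ltw]]; split=> //.
- move=> u v Ew u0 v0.
  (* Otherwise u and v are powers of a common word, and so is w. *)
  have neq : w != v ++ u.
    apply/eqP => E; have [t [i [j [Eu Ev]]]] : exists t i j,
        u = word_pow t i /\ v = word_pow t j.
      by apply: commuting_words; rewrite -Ew.
    have t0 : t <> [::].
      by move=> t0; apply: u0; rewrite Eu t0 /word_pow; elim: (i).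
    have := prim t (i + j) t0; rewrite word_powD -Eu -Ev => /(_ Ew).
    case: i Eu => [/u0//|i] _; case: j Ev => [/v0//|j] _.
    by rewrite addSn addnS.
  have ltvu : word_lt w (v ++ u).
    by rewrite word_lt_neqAle neq; apply: minw; exists u, v.
  rewrite word_ltNge; apply/negP => le_vw.
  have [/prefixP[z Ez]|npre] := boolP (prefix v w).
    have szu : size u = size z.
      by move/(congr1 size): Ew; rewrite Ez !size_cat addnC => /addIn.
    have ltzu : word_lt z u by move: ltvu; rewrite {1}Ez word_lt_cat2l.
    have : word_lt (z ++ v) w.
      rewrite Ew; apply: word_lt_cat => //.
      apply/negP => /prefixP[y Ey].
      move: szu ltzu; rewrite Ey size_cat => /eqP.
      rewrite -{2}[size z]addn0 eqn_add2l size_eq0 => /eqP->.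
      by rewrite cats0 word_ltxx.
    by rewrite word_ltNge minw //; exists v, z.
  have : word_lt v w.
    rewrite word_lt_neqAle le_vw andbT; apply: contraNneq npre => ->.
    exact: prefix_refl.
  move/(word_lt_cat u [::])/(_ npre); rewrite cats0.
  by rewrite word_ltNge (word_ltW ltvu).
- split=> // u [|[|k]] u0 // Ew.
  have := ltw u (word_pow u k.+1) Ew u0.
  have -> : word_lt w (word_pow u k.+1) = false.
    apply/negbTE; rewrite -word_leNgt Ew -[k.+2]addn1 word_powD.
    exact: word_le_catr.
  suff Ek : word_pow u k.+1 <> [::] by move/(_ Ek).
  by case: (u) u0.
- move=> _ [u [v [Ew ->]]].
  have [u0|/eqP u0] := eqVneq u [::].
    by rewrite Ew u0 cats0 word_le_refl.
  have [v0|/eqP v0] := eqVneq v [::].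
    by rewrite Ew v0 cats0 word_le_refl.
  apply: (word_le_trans (v := v)); last exact: word_le_catr.
  exact: word_ltW (ltw _ _ Ew u0 v0).
Qed.

Lemma Lyndon_nonempty (n : nat) (w : word n) : Lyndon_word w -> w <> [::].
Proof. by case=> -[]. Qed.

Lemma Lyndon_letter (n : nat) (c : 'I_n) : Lyndon_word [:: c].
Proof.
by apply/Lyndon_wordP; split=> // -[|c' [|d u]] // v [_ <-].
Qed.

Lemma Lyndon_cat (n : nat) (u v : word n) :
  Lyndon_word u -> Lyndon_word v -> word_lt u v -> Lyndon_word (u ++ v).
Proof.
move=> /Lyndon_wordP[u0 ltu] /Lyndon_wordP[v0 ltv] uv.
(* A nonempty proper suffix of uv is a suffix of v, which is at least v, or sv
   with s a proper suffix of u, whose comparison with u is decided inside s. *)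
have uv_v : word_lt (u ++ v) v.
  have [/prefixP[z Ez]|npre] := boolP (prefix u v); last first.
    by rewrite -[X in word_lt _ X]cats0; apply: word_lt_cat.
  rewrite [X in word_lt _ X]Ez word_lt_cat2l; apply: (ltv u) => // z0.
  by move: uv; rewrite Ez z0 cats0 word_ltxx.
apply/Lyndon_wordP; split=> [|x y Exy x0 y0]; first by case: (u) u0.
case: (leqP (size u) (size x)) => [le_ux|lt_xu].
  have [x' Ex Ev] := cat_overlap (esym Exy) le_ux.
  apply: (word_lt_le_trans uv_v).
  have [x'0|/eqP x'0] := eqVneq x' [::]; first by rewrite Ev x'0 word_le_refl.
  exact: word_ltW (ltv _ _ Ev x'0 y0).
have [s Eu ->] := cat_overlap Exy (ltnW lt_xu).
have s0 : s <> [::] by move=> s0; move: lt_xu; rewrite Eu s0 cats0 ltnn.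
apply: word_lt_cat; first exact: ltu Eu x0 s0.
apply/negP => /size_prefix; rewrite Eu size_cat.
by case: (x) x0 => //= ? ? _; rewrite ltnNge leq_addl.
Qed.

(** * The Chen-Fox-Lyndon theorem *)

(** As long as l is smaller than the first factor, the two are merged into a
    longer Lyndon word. *)
Lemma Lyndon_insert (n : nat) (l : word n) ls :
  Lyndon_word l -> (forall l', l' \in ls -> Lyndon_word l') ->
  sorted (fun l l' : word n => word_le l' l) ls ->
  exists ls', is_Lyndon_factorization (l ++ flatten ls) ls'.
Proof.
elim: ls l => [|p ls IH] l Ll Lls srt.
  by exists [:: l]; split=> // l'; rewrite inE => /eqP ->.
have Lp : Lyndon_word p by apply: Lls; rewrite mem_head.
have [lt_lp|] := boolP (word_lt l p).
  rewrite /= catA; apply: IH; first exact: Lyndon_cat.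
    by move=> l' l'ls; apply: Lls; rewrite inE l'ls orbT.
  exact: path_sorted srt.
rewrite -word_leNgt => le_pl; exists (l :: p :: ls); split=> //=.
  by move=> l'; rewrite inE => /predU1P[->//|/Lls].
by rewrite le_pl.
Qed.

Lemma Lyndon_factorization_exists (n : nat) (w : word n) :
  exists ls, is_Lyndon_factorization w ls.
Proof.
elim: w => [|c w [ls [<- Lls srt]]]; first by exists [::].
exact: (Lyndon_insert (Lyndon_letter c)).
Qed.

Lemma prefix_flatten (T : eqType) (p : seq T) ls :
  p <> [::] -> prefix p (flatten ls) ->
  exists l x q, [/\ l \in ls, p = x ++ q, q <> [::] & prefix q l].
Proof.
elim: ls p => [|l ls IH] p p0 /=; first by case: p p0.
case/prefixP=> s E; case: (leqP (size p) (size l)) => [le_pl|lt_lp].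
  have [t El _] := cat_overlap E le_pl.
  by exists l, [::], p; split; rewrite ?mem_head // El prefix_prefix.
have [p' Ep Els] := cat_overlap (esym E) (ltnW lt_lp).
have [||l' [x [q [l'ls Eq q0 preq]]]] := IH p'.
- by move=> p'0; rewrite Ep p'0 cats0 ltnn in lt_lp.
- by rewrite Els prefix_prefix.
exists l', (l ++ x), q; split=> //; first by rewrite inE l'ls orbT.
by rewrite -catA -Eq.
Qed.

(** The first factor l of a nonincreasing factorization is the longest Lyndon
    prefix: a longer one p would have a proper suffix q that is a prefix of a
    later factor l', whence p < q <= l' <= l <= p. *)
Lemma Lyndon_prefix_size (n : nat) (l p : word n) ls :
  Lyndon_word p -> prefix p (l ++ flatten ls) -> l <> [::] ->
  path (fun l l' : word n => word_le l' l) l ls -> size p <= size l.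
Proof.
move=> /Lyndon_wordP[p0 ltp] /prefixP[s E] l0 srt.
rewrite leqNgt; apply/negP => lt_lp.
have [p' Ep Els] := cat_overlap (esym E) (ltnW lt_lp).
have [||l' [x [q [l'ls Eq q0 /prefixP[z Ez]]]]] := @prefix_flatten _ p' ls.
- by move=> p'0; rewrite Ep p'0 cats0 ltnn in lt_lp.
- by rewrite Els prefix_prefix.
have : word_lt p q.
  by apply: (ltp (l ++ x)); [rewrite -catA -Eq|case: (l) l0|].
rewrite word_ltNge => /negP; apply.
apply: (word_le_trans (v := l')); first by rewrite Ez word_le_catr.
apply: (word_le_trans (v := l)); last by rewrite Ep word_le_catr.
have := order_path_min _ srt => /(_ _)/allP; apply=> // a b c le1 le2.
exact: word_le_trans le2 le1.
Qed.

Lemma Lyndon_factorization_unique (n : nat) (w : word n) ls ps :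
  is_Lyndon_factorization w ls -> is_Lyndon_factorization w ps -> ls = ps.
Proof.
elim: ls w ps => [|l ls IH] w [|p ps] // [Ew Lls srt] [Ew' Lps srt'].
- have := Lyndon_nonempty (Lps p (mem_head _ _)).
  by case: (p) Ew' => //; rewrite -Ew.
- have := Lyndon_nonempty (Lls l (mem_head _ _)).
  by case: (l) Ew => //; rewrite -Ew'.
have Ll := Lls l (mem_head _ _); have Lp := Lps p (mem_head _ _).
have E : l ++ flatten ls = p ++ flatten ps := etrans Ew (esym Ew').
have sz : size l = size p.
  apply/eqP; rewrite eqn_leq; apply/andP; split.
    apply: (Lyndon_prefix_size (ls := ps)) => //; last exact: Lyndon_nonempty.
    by rewrite -E prefix_prefix.
  apply: (Lyndon_prefix_size (ls := ls)) => //; last exact: Lyndon_nonempty.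
  by rewrite E prefix_prefix.
move/eqP: E; rewrite eqseq_cat // => /andP[/eqP<- /eqP E]; congr (_ :: _).
apply: (IH (flatten ls)); split=> //; last 2 first.
- by move=> q qps; apply: Lps; rewrite inE qps orbT.
- exact: path_sorted srt'.
- by move=> q qls; apply: Lls; rewrite inE qls orbT.
- exact: path_sorted srt.
Qed.

Lemma Lyndon_factorizationP (n : nat) (w : word n) ls :
  is_Lyndon_factorization w ls <-> Lyndon_factorization w = ls.
Proof.
have Fw : is_Lyndon_factorization w (Lyndon_factorization w).
  have [ls0 Fls0] := Lyndon_factorization_exists w.
  exact: (@xgetPex _ [::] (fun ls => is_Lyndon_factorization w ls)
           (ex_intro _ ls0 Fls0)).
by split=> [|<-//]; apply: Lyndon_factorization_unique.
Qed.

(** * Splitting a word into nonempty blocks *)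

(** The first letter is either a block of its own or joins the first block of
    a splitting of the rest.  An explicit list makes the sums over
    factorizations finite. *)
Fixpoint splittings (T : eqType) (x : seq T) : seq (seq (seq T)) :=
  if x is c :: x' then
    [seq [:: c] :: ls | ls <- splittings x'] ++
    [seq (c :: head [::] ls) :: behead ls | ls <- splittings x' & ls != [::]]
  else [:: [::]].

Lemma mem_splittings (T : eqType) (x : seq T) ls :
  (ls \in splittings x) = (flatten ls == x) && ([::] \notin ls).
Proof.
elim: x ls => [|c x IH] ls.
  by rewrite inE; case: ls => [|[|d l] ls] //=; rewrite ?inE ?andbF.
rewrite /= mem_cat; apply/orP/andP => [[]|[/eqP E nil]].
- case/mapP=> ls'; rewrite IH => /andP[/eqP <- nil] ->.
  by rewrite /= inE /= eqxx nil.
- case/mapP=> -[|l ls']; rewrite mem_filter //= IH => /andP[/eqP <- nil] ->.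
  by move: nil; rewrite /= !inE negb_or eqxx => /andP[_ ->].
case: ls E nil => [|[|d [|e l]] ls] //; rewrite ?inE //=.
  by case=> -> E nil; left; apply/mapP; exists ls => //; rewrite IH E eqxx.
case=> -> E nil; right; apply/mapP; exists ((e :: l) :: ls) => //.
by rewrite mem_filter IH /= E eqxx inE.
Qed.

Lemma splittings_uniq (T : eqType) (x : seq T) : uniq (splittings x).
Proof.
elim: x => //= c x IH; rewrite cat_uniq; apply/and3P; split.
- by rewrite map_inj_uniq // => ls ls' [].
- apply/hasPn => qs /mapP[[|l ls]]; rewrite mem_filter //= mem_splittings inE.
  case/andP=> _ /norP[l0 _] ->; apply/mapP => -[ls' _ [E _]].
  by rewrite E eqxx in l0.
- rewrite map_inj_in_uniq ?filter_uniq // => -[|l ls] [|l' ls'].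
  all: by rewrite !mem_filter //= => _ _ [-> ->].
Qed.

(** Cutting a splitting of x between two blocks amounts to cutting x itself
    and splitting both parts. *)
Lemma sum_splittings_cut (T : eqType) (R : nmodType) (x : seq T)
    (f : seq (seq T) -> seq (seq T) -> R) :
  (\sum_(ls <- splittings x) \sum_(0 <= i < (size ls).+1)
      f (take i ls) (drop i ls) =
   \sum_(0 <= j < (size x).+1) \sum_(ls <- splittings (take j x))
      \sum_(ps <- splittings (drop j x)) f ls ps)%R.
Proof.
(* Both sums run over the pairs of sequences of nonempty blocks whose
   joint concatenation is x. *)
pose cuts := [seq (take i ls, drop i ls)
              | ls <- splittings x, i <- index_iota 0 (size ls).+1].
pose pairs := [seq p | j <- index_iota 0 (size x).+1,
   p <- [seq (ls, ps) | ls <- splittings (take j x),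
                        ps <- splittings (drop j x)]].
transitivity (\sum_(p <- cuts) f p.1 p.2)%R; first by rewrite big_allpairs_dep.
transitivity (\sum_(p <- pairs) f p.1 p.2)%R; last first.
  by rewrite big_allpairs_dep; apply: eq_bigr => j _; rewrite big_allpairs.
apply: perm_big; apply: uniq_perm.
- apply: allpairs_uniq_dep => [||].
  + exact: splittings_uniq.
  + by move=> ls _; apply: iota_uniq.
  + move=> [ls i] [ps j] /allpairsPdep[ls1 [i1 [_ i1lt E1]]].
    case/allpairsPdep=> ls2 [i2 [_ i2lt E2]] /= [Et Ed].
    case: E1 => ? ?; case: E2 => ? ?; subst ls1 i1 ls2 i2.
    have E : ls = ps by rewrite -(cat_take_drop i ls) Et Ed cat_take_drop.
    subst ps; move: i1lt i2lt; rewrite !mem_index_iota !ltnS /= => i1 i2.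
    by move/(congr1 size): Et; rewrite !size_takel // => ->.
- apply: allpairs_uniq_dep => [||].
  + exact: iota_uniq.
  + move=> j _; apply: allpairs_uniq; try exact: splittings_uniq.
    by move=> [? ?] [? ?] _ _ /= [-> ->].
  + move=> [j p] [k q] /allpairsPdep[j1 [p1 [j1lt p1P E1]]].
    case/allpairsPdep=> j2 [p2 [j2lt p2P E2]] /= E.
    case: E1 => ? ?; case: E2 => ? ?; subst j1 p1 j2 p2 q.
    case/allpairsP: p1P => -[? ?] /= []; case/allpairsP: p2P => -[? ?] /= [].
    rewrite !mem_splittings => /andP[/eqP Ek _] _ -> /andP[/eqP Ej _] _ [E _].
    move: j1lt j2lt; rewrite !mem_index_iota !ltnS /= => lej lek.
    by move: Ej; rewrite -E Ek => /(congr1 size); rewrite !size_takel // => ->.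
- move=> [ls ps]; apply/allpairsPdep/allpairsPdep.
  + case=> ss [i [ssx _ [-> ->]]]; exists (size (flatten (take i ss))).
    exists (take i ss, drop i ss).
    move: ssx; rewrite mem_splittings => /andP[/eqP <-].
    rewrite -{1}(cat_take_drop i ss) mem_cat negb_or => /andP[n1 n2].
    have Ess : flatten ss = flatten (take i ss) ++ flatten (drop i ss).
      by rewrite -flatten_cat cat_take_drop.
    split=> //; first by rewrite mem_index_iota Ess size_cat ltnS leq_addr.
    apply/allpairsP; exists (take i ss, drop i ss); split=> //=;
      rewrite mem_splittings.
      by rewrite n1 Ess take_size_cat // eqxx.
    by rewrite n2 Ess drop_size_cat // eqxx.
  + case=> j [_ [_ /allpairsP[[ls' ps'] /= [+ + ->]] [-> ->]]].
    rewrite !mem_splittings => /andP[/eqP E1 n1] /andP[/eqP E2 n2].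
    exists (ls' ++ ps'), (size ls'); split.
    * by rewrite mem_splittings flatten_cat E1 E2 cat_take_drop eqxx mem_cat
                 negb_or n1.
    * by rewrite mem_index_iota size_cat ltnS /= leq_addr.
    * by rewrite take_size_cat // drop_size_cat.
Qed.

(** * Cancellation of the cuts of a sequence *)

(** The sign is the parity of the length of the increasing part.  Moving the
    entry at the cut from one side to the other is a sign-reversing
    involution: if a and b are the last entry before an admissible cut and the
    first one after it, only b can be moved when lt a b holds, and only a
    otherwise.  In the induction, the cuts 0 and 1 of x :: y :: s cancel and
    the others vanish unless lt x y holds; then the cut 0 vanishes and the
    others are those of y :: s with the opposite sign. *)
Lemma sum_boundary_eq0 (T : Type) (lt : rel T) (s : seq T) :
  (0 < size s)%N ->
  (\sum_(0 <= i < (size s).+1)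
     (-1) ^+ i *+ (sorted lt (take i s) &&
                   sorted (fun x y => ~~ lt x y) (drop i s)) = 0%R :> int)%R.
Proof.
case: s => // x s _; elim: s x => [|y s IH] x.
  by rewrite big_nat_recl // big_nat1 /= expr0 expr1 !mulr1n addrN.
rewrite big_nat_recl // big_nat_recl //= expr0 expr1.
have {IH} := IH y; rewrite [X in X = _ -> _]big_nat_recl // /= expr0.
case: (lt x y) => /= IHy; last first.
  by rewrite big1 ?addr0 ?mulNrn ?addrN // => i _; rewrite mulr0n.
rewrite mulr0n add0r -[RHS]oppr0 -[in RHS]IHy opprD mulNrn.
congr (_ + _)%R; rewrite -sumrN; apply: eq_bigr => i _.
by rewrite exprS mulN1r mulNrn.
Qed.

(** * Increasing products of Lyndon words *)

Definition all_Lyndon (n : nat) (ls : seq (word n)) : bool :=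
  all (fun l => `[< Lyndon_word l >]) ls.

(** The coefficient of the word x in the product of the 1 - l, taken over the
    Lyndon words l in increasing order, in noncommuting variables. *)
Definition signed_increasing (n : nat) (x : word n) : int :=
  (\sum_(ls <- splittings x | all_Lyndon ls && sorted (@word_lt n) ls)
     (-1) ^+ size ls)%R.

Lemma all_LyndonP (n : nat) (ls : seq (word n)) :
  reflect (forall l, l \in ls -> Lyndon_word l) (all_Lyndon ls).
Proof. by apply: (iffP allP) => H l /H /asboolP. Qed.

Lemma all_Lyndon_nonempty (n : nat) (ls : seq (word n)) :
  all_Lyndon ls -> [::] \notin ls.
Proof. by move=> /all_LyndonP H; apply/negP => /H/Lyndon_nonempty. Qed.

Lemma size_all_Lyndon (n : nat) (ls : seq (word n)) :
  all_Lyndon ls -> size ls <= size (flatten ls).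
Proof.
move/all_Lyndon_nonempty; elim: ls => //= l ls IH; rewrite inE negb_or size_cat.
by case: l => // c l /IH /= le; rewrite addSn ltnS (leq_trans le) ?leq_addl.
Qed.

Lemma is_Lyndon_factorizationE (n : nat) (w : word n) ls :
  is_Lyndon_factorization w ls <->
  (ls \in splittings w) &&
  (all_Lyndon ls && sorted (fun l l' => ~~ word_lt l l') ls).
Proof.
have sortE : sorted (fun l l' : word n => ~~ word_lt l l') ls =
             sorted (fun l l' : word n => word_le l' l) ls.
  by apply: eq_sorted => l l'; rewrite word_leNgt.
rewrite mem_splittings sortE; split.
  case=> -> /all_LyndonP Lls ->.
  by rewrite eqxx all_Lyndon_nonempty // Lls.
by case/andP=> /andP[/eqP E _] /andP[/all_LyndonP Lls srt].
Qed.

(** Existence and uniqueness of the Lyndon factorization, as a sum. *)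
Lemma count_nonincreasing (n : nat) (w : word n) :
  (\sum_(ls <- splittings w | all_Lyndon ls &&
     sorted (fun l l' => ~~ word_lt l l') ls) 1%R = 1%R :> int)%R.
Proof.
have /is_Lyndon_factorizationE/andP[inw okw] :=
  (Lyndon_factorizationP w (Lyndon_factorization w)).2 erefl.
rewrite big_mkcond (bigD1_seq _ inw (splittings_uniq w)) /= okw.
rewrite big1_seq ?addr0 // => ls /andP[neq lsw].
case: ifP => // okls; case/eqP: neq; apply/esym/Lyndon_factorizationP.
by apply/is_Lyndon_factorizationE; rewrite lsw.
Qed.

(** The weight 1 of the remaining suffix is expanded as the number of its
    nonincreasing factorizations; then the cuts of each sequence of Lyndon
    words cancel. *)
Lemma sum_prefix_signed_increasing (n : nat) (x : word n) :
  x <> [::] ->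
  (\sum_(0 <= j < (size x).+1) signed_increasing (take j x) = 0)%R.
Proof.
move=> x0.
pose f (ls ps : seq (word n)) : int :=
  ((-1) ^+ size ls *+ ((all_Lyndon ls && sorted (@word_lt n) ls) &&
    (all_Lyndon ps && sorted (fun l l' => ~~ word_lt l l') ps)))%R.
transitivity (\sum_(0 <= j < (size x).+1) \sum_(ls <- splittings (take j x))
      \sum_(ps <- splittings (drop j x)) f ls ps)%R.
  apply: eq_bigr => j _; rewrite /signed_increasing big_mkcond.
  apply: eq_bigr => ls _; rewrite /f; case: (_ && sorted _ ls) => /=;
    last by rewrite big1.
  rewrite -[LHS]mulr1 -(count_nonincreasing (drop j x)) mulr_sumr big_mkcond.
  by apply: eq_bigr => ps _; case: ifP => _; rewrite ?mulr1.
rewrite -sum_splittings_cut big1_seq // => ls /=.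
rewrite mem_splittings => /andP[/eqP Ex _].
have ls0 : 0 < size ls by case: ls Ex x0 => // <-.
transitivity (\sum_(0 <= i < (size ls).+1)
    (-1) ^+ i *+ (sorted (@word_lt n) (take i ls) &&
      sorted (fun l l' => ~~ word_lt l l') (drop i ls)) *+ all_Lyndon ls
    : int)%R.
  apply: eq_big_nat => i /andP[_ ile].
  rewrite /f andbACA -all_cat cat_take_drop size_takel // -/(all_Lyndon ls).
  by case: (all_Lyndon ls); rewrite ?mulr1n ?mulr0n.
by rewrite sumrMnl sum_boundary_eq0 ?mul0rn.
Qed.

(** The sums over the prefixes of x and over those of x without its last letter
    both vanish, and they differ by the term of x; the shorter word must be
    nonempty, which is where two letters are needed. *)
Lemma signed_increasing_eq0 (n : nat) (x : word n) :
  1 < size x -> signed_increasing x = 0%R.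
Proof.
case/lastP: x => [|y c] //; rewrite size_rcons ltnS => y0.
have := @sum_prefix_signed_increasing _ (rcons y c).
rewrite size_rcons big_nat_recr //= take_oversize ?size_rcons //.
rewrite (_ : (\sum_(0 <= j < _) _ = 0)%R) ?add0r; first by apply; case: (y).
rewrite -[RHS](@sum_prefix_signed_increasing _ y); last by case: (y) y0.
apply: eq_big_nat => j /andP[_ jy].
by rewrite -cats1 takel_cat.
Qed.

(** * From words to increasing products *)

Lemma Nwords_perm (n : nat) (m : 'I_n -> nat)
    (w : (mset_card m).-tuple 'I_n) (s : word n) :
  w \in Nwords m -> perm_eq s w ->
  exists2 w' : (mset_card m).-tuple 'I_n, w' \in Nwords m & val w' = s.
Proof.
rewrite inE => /forallP wm sw.
have sz : size s == mset_card m by rewrite (perm_size sw) size_tuple.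
exists (Tuple sz) => //; rewrite inE; apply/forallP => i /=.
by rewrite (permP sw).
Qed.

Lemma Lyndon_factorization_spec (n : nat) (w : word n) :
  is_Lyndon_factorization w (Lyndon_factorization w).
Proof. exact: (Lyndon_factorizationP w _).2. Qed.

Lemma flatten_rev_perm (T : eqType) (ls : seq (seq T)) :
  perm_eq (flatten (rev ls)) (flatten ls).
Proof. by apply: perm_flatten; rewrite perm_rev. Qed.

(** Both sides run over the same set, the strictly increasing sequences of
    Lyndon words whose total content is M: on the left they are the Lyndon
    tuples of words over M, on the right the factorizations of their own
    products, which are again words over M. *)
Lemma sum_Lyndon_tuples (n : nat) (m : 'I_n -> nat) :
  (\sum_(w in Nwords m | has_Lyndon_tuple w)
      (-1) ^+ size (Lyndon_factorization w) =
   \sum_(w in Nwords m) signed_increasing w :> int)%R.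
Proof.
pose tuples := [seq rev (Lyndon_factorization (val w))
                  | w <- enum (Nwords m) & has_Lyndon_tuple (val w)].
pose incr (ls : seq (word n)) := all_Lyndon ls && sorted (@word_lt n) ls.
pose products := [seq ls | w <- enum (Nwords m),
                           ls <- [seq ls <- splittings (val w) | incr ls]].
transitivity (\sum_(ls <- tuples) (-1) ^+ size ls : int)%R.
  rewrite big_map big_filter -big_enum_cond.
  by apply: eq_bigr => w _; rewrite size_rev.
transitivity (\sum_(ls <- products) (-1) ^+ size ls : int)%R; last first.
  rewrite big_allpairs_dep -big_enum.
  by apply: eq_bigr => w _; rewrite big_filter.
apply: perm_big; apply: uniq_perm.
- rewrite map_inj_uniq; first exact/filter_uniq/enum_uniq.
  move=> w w' /(congr1 rev).
  rewrite !revK => E; apply: val_inj.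
  have [<- _ _] := Lyndon_factorization_spec (val w).
  by have [<- _ _] := Lyndon_factorization_spec (val w'); rewrite E.
- apply: allpairs_uniq_dep => [||].
  + exact: enum_uniq.
  + by move=> w _; rewrite filter_uniq ?splittings_uniq.
  + move=> [w ls] [w' ls'] /allpairsPdep[w1 [ls1 [_ ls1P E1]]].
    case/allpairsPdep=> w2 [ls2 [_ ls2P E2]] /= E.
    case: E1 => ? ?; case: E2 => ? ?; subst w1 ls1 w2 ls2 ls'.
    move: ls1P ls2P; rewrite !mem_filter !mem_splittings.
    move=> /and3P[_ /eqP E1 _] /and3P[_ /eqP E2 _].
    by have -> : w = w' by apply: val_inj; rewrite -E1 -E2.
have sortE (ls : seq (word n)) : sorted (@word_lt n) ls =
    uniq ls && sorted (fun l l' : word n => word_le l l') ls.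
  exact: (@lt_sorted_uniq_le _ (seqlexi 'I_n)).
move=> ls; apply/mapP/allpairsPdep.
- case=> w; rewrite mem_filter mem_enum => /andP[uw wm] ->.
  have [Ew Lw sw] := Lyndon_factorization_spec (val w).
  have [|w' w'm Ew'] := @Nwords_perm _ _ w
    (flatten (rev (Lyndon_factorization (val w)))) wm.
    by apply: perm_trans (flatten_rev_perm _) _; rewrite Ew.
  exists w', (rev (Lyndon_factorization (val w))); split=> //.
    by rewrite mem_enum.
  have Lr : all_Lyndon (rev (Lyndon_factorization (val w))).
    by apply/all_LyndonP => l; rewrite mem_rev; apply: Lw.
  rewrite mem_filter mem_splittings Ew' eqxx all_Lyndon_nonempty // andbT.
  rewrite /incr Lr.
  by rewrite sortE rev_uniq rev_sorted /= sw !andbT.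
- case=> w [ls' [wm + ->]]; rewrite mem_filter mem_splittings.
  move=> /and3P[/andP[Lls srt] /eqP Ew _]; rewrite mem_enum in wm.
  have [|w' w'm Ew'] := @Nwords_perm _ _ w (flatten (rev ls')) wm.
    by apply: perm_trans (flatten_rev_perm _) _; rewrite Ew.
  move: srt; rewrite sortE => /andP[uls srt].
  have Fw' : Lyndon_factorization (val w') = rev ls'.
    apply/Lyndon_factorizationP; split=> //.
      by move=> l; rewrite mem_rev; move: l; apply/all_LyndonP.
    by rewrite rev_sorted.
  exists w'; last by rewrite Fw' revK.
  by rewrite mem_filter mem_enum w'm andbT /has_Lyndon_tuple Fw' rev_uniq.
Qed.

Lemma prod_count_mem (R : comNzRingType) (I : finType) (F : I -> R)
    (s : seq I) :
  (\prod_(i <- s) F i = \prod_i F i ^+ count_mem i s)%R.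
Proof.
elim: s => [|c s IH]; first by rewrite big_nil big1.
rewrite big_cons IH /=; under [RHS]eq_bigr do rewrite exprD.
rewrite big_split /=; congr (_ * _)%R.
rewrite (bigD1 c) //= eqxx expr1 big1 ?mulr1 // => i.
by rewrite eq_sym => /negbTE ->.
Qed.

Lemma wt_Nword (n : nat) (m : 'I_n -> nat) (w : (mset_card m).-tuple 'I_n) :
  w \in Nwords m -> (wt w = \prod_i 'X_i ^+ m i)%R.
Proof.
rewrite inE => /forallP wm; have [Ew _ _] := Lyndon_factorization_spec w.
rewrite /wt /Lyndon_tuple /wt_Lyndon -big_flatten.
rewrite (perm_big _ (flatten_rev_perm _)) Ew prod_count_mem.
by apply: eq_bigr => i _; rewrite (eqP (wm i)).
Qed.

(** The Lyndon index is N - k for k factors, so that counting with the sign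
    (-1)^k is, up to (-1)^N, subtracting odd words from even ones. *)
Lemma card_even_odd_Nwords (n : nat) (m : 'I_n -> nat) :
  1 < mset_card m -> #|even_Nwords m| = #|odd_Nwords m|.
Proof.
move=> m1; have sum0 : (\sum_(w in Nwords m | has_Lyndon_tuple w)
    (-1) ^+ Lyndon_index w = 0%R :> int)%R.
  transitivity ((-1) ^+ mset_card m *
      \sum_(w in Nwords m) signed_increasing w : int)%R; last first.
    by rewrite big1 ?mulr0 // => w _; rewrite signed_increasing_eq0 ?size_tuple.
  rewrite -sum_Lyndon_tuples mulr_sumr; apply: eq_bigr => w _.
  have [Ew /all_LyndonP/size_all_Lyndon le _] := Lyndon_factorization_spec w.
  rewrite /Lyndon_index /Lyndon_tuple size_rev -[LHS]signr_odd oddB;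
    last by rewrite -{2}Ew.
  by rewrite size_tuple signr_addb !signr_odd.
apply/eqP; rewrite -(@Num.Theory.eqr_nat int) -subr_eq0 -sum0 -!sumr_const.
pose odd_index (w : (mset_card m).-tuple 'I_n) := odd (Lyndon_index w).
rewrite [X in _ == X](bigID odd_index) /= addrC -sumrN.
apply/eqP; congr (_ + _)%R.
- apply: eq_big => [w|w]; first by rewrite !inE /even_word andbA.
  by rewrite inE /even_word -signr_odd => /and3P[_ _ /negbTE->].
- apply: eq_big => [w|w]; first by rewrite !inE /odd_word andbA.
  by rewrite inE /odd_word -signr_odd => /and3P[_ _ ->].
Qed.

Theorem theorem4p2 (n : nat) (m : 'I_n -> nat) (hN : (1 < mset_card m)%N) :
  (\sum_(w in even_Nwords m) wt w = \sum_(w in odd_Nwords m) wt w)%R.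
Proof.
rewrite (eq_bigr (fun=> \prod_i 'X_i ^+ m i)%R) => [|w]; last first.
  by rewrite inE => /andP[/wt_Nword].
rewrite [RHS](eq_bigr (fun=> \prod_i 'X_i ^+ m i)%R) => [|w]; last first.
  by rewrite inE => /andP[/wt_Nword].
by rewrite !sumr_const card_even_odd_Nwords.
Qed.
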